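(* Let $G$ be a finite, simple, undirected, connected graph with chromatic number $\chi(G)=k$. Then there is a $k$-coloring $f$ of $G$ such that every vertex of $G$ lies on a full $f$-rainbow path.
   Context: For a positive integer $k$, $[k]=\{1,\dots,k\}$. A $k$-coloring of $G$ is a function $f:V(G)\to[k]$ with $f(u)\neq f(v)$ for every two adjacent vertices $u,v$. The chromatic number $\chi(G)$ is the minimum $k$ such that $G$ has a $k$-coloring. For a $k$-coloring $f$, an $f$-rainbow path is a path $P$ in $G$ such that $f(u)\neq f(v)$ for every two distinct vertices $u,v$ of $P$; it is full if it has order (number of vertices) $k$, i.e. all $k$ colors appear on $P$. *)

(* Defs.v *)
From mathcomp Require Import all_boot.
Set Implicit Arguments. Unset Strict Implicit. Unset Printing Implicit Defensive.

Definition simple_graph (T : finType) (e : rel T) : Prop :=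
  symmetric e /\ irreflexive e.

Definition connected_graph (T : finType) (e : rel T) : Prop :=
  forall x y : T, connect e x y.

Definition is_coloring (T : finType) (e : rel T) (k : nat) (f : T -> 'I_k) : Prop :=
  forall u v : T, e u v -> f u != f v.

Definition colorable (T : finType) (e : rel T) (k : nat) : Prop :=
  exists f : T -> 'I_k, is_coloring e f.

Definition chromatic_number (T : finType) (e : rel T) (k : nat) : Prop :=
  colorable e k /\ forall j, j < k -> ~ colorable e j.

Definition is_graph_path (T : finType) (e : rel T) (p : seq T) : Prop :=
  match p with
  | [::] => False
  | x :: q => path e x q /\ uniq p
  end.

Definition rainbow_path (T : finType) (e : rel T) (k : nat) (f : T -> 'I_k)
  (p : seq T) : Prop :=
  is_graph_path e p /\ uniq (map f p).

Definition full_rainbow_path (T : finType) (e : rel T) (k : nat) (f : T -> 'I_k)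
  (p : seq T) : Prop :=
  rainbow_path e f p /\ size p = k.

(* Main.v *)
Require Import Defs.
From mathcomp Require Import all_boot.

(* Write k = n + 1 and let the colors be a special color None and n cyclically
   ordered ones.  In a k-coloring with the fewest vertices colored None, every
   such vertex z starts, for each color c, a path whose colors run down the
   whole cycle c, c - 1, ..., c + 1: otherwise shifting the vertices reachable
   from z by such steps would recolor z.  These paths form a first set S of
   vertices lying on full rainbow paths inside S.  The set S is then enlarged
   vertex by vertex, the complement of S always avoiding None.  Rotate the
   colors outside S until some u outside S and some neighbor s in S have
   consecutive colors.  If the ascending path from s meets None after fewer
   than n vertices, then u prolongs it to a full rainbow path; if instead s
   starts an ascending path through all n cyclic colors, then either u has a
   neighbor colored None, which precedes u on a full rainbow path, or u itself
   can be recolored None. *)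

Set Implicit Arguments. Unset Strict Implicit. Unset Printing Implicit Defensive.

(** * Iterates and the cyclic order of colors *)

Lemma iter_cancel (A : Type) (f h : A -> A) i :
  cancel f h -> cancel (iter i f) (iter i h).
Proof. by move=> fK; elim: i => // i IHi x; rewrite [iter i.+1 f x]iterS iterSr fK IHi. Qed.

Lemma rev_traject (A : Type) (f h : A -> A) x i : cancel f h ->
  rev (traject f x i.+1) = traject h (iter i f x) i.+1.
Proof.
move=> fK; elim: i => // i IHi.
by rewrite trajectSr rev_rcons IHi [RHS]trajectS iterS fK.
Qed.

Section CyclicOrder.
Variable n : nat.
Implicit Types a b c : 'I_n.

Lemma val_iter_ordS a i : iter i (@ordS n) a = (a + i) %% n :> nat.
Proof.
elim: i => [|i IHi]; first by rewrite addn0 modn_small.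
by rewrite iterS /= IHi -addn1 modnDml addn1 addnS.
Qed.

Lemma uniq_traject_ordS a : uniq (traject (@ordS n) a n).
Proof.
apply/(uniqP a) => i j; rewrite !inE size_traject => lt_in lt_jn.
rewrite !nth_traject // => /(congr1 val) /=; rewrite !val_iter_ordS.
by move/eqP; rewrite eqn_modDl !modn_small // => /eqP.
Qed.

Lemma iter_ordS_transitive a b : exists i, iter i (@ordS n) a = b.
Proof.
exists (b + (n - a)); apply: val_inj; rewrite /= val_iter_ordS.
by rewrite addnCA subnKC ?(ltnW (ltn_ord a)) // modnDr modn_small.
Qed.

Lemma uniq_traject_ord_pred a : uniq (traject (@ord_pred n) a n).
Proof.
have n_gt0 : 0 < n by apply: leq_ltn_trans (ltn_ord a).
rewrite -rev_uniq -[X in traject _ _ X](prednK n_gt0).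
by rewrite (rev_traject _ _ (@ord_predK n)) prednK ?uniq_traject_ordS.
Qed.

(** Undoing the [i - 1] descents shows that [i] ascents fix [c], so [n] divides [i]. *)
Lemma iter_ord_pred_full c i :
  0 < i -> iter i.-1 (@ord_pred n) c = ordS c -> n <= i.
Proof.
case: i => // i _ /= /(congr1 (iter i (@ordS n))).
rewrite (iter_cancel i (@ord_predK n)) -iterSr => def_c.
have: c + i.+1 == c + 0 %[mod n] by rewrite -val_iter_ordS -def_c addn0 modn_small.
by rewrite eqn_modDl mod0n => /dvdn_leq->.
Qed.

End CyclicOrder.

(** * Full paths inside a set, and the invariant of the growth *)

Section RainbowGrowth.
Variables (T : finType) (e : rel T) (n : nat).
Hypothesis e_sym : symmetric e.
Hypothesis n_gt0 : 0 < n.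
Implicit Types (g : T -> option 'I_n) (S : {set T}) (p q r : seq T).

Let up := map (fun c : 'I_n => Some c).

Lemma mem_None_up (x : seq 'I_n) : None \notin up x.
Proof. by apply/mapP => -[]. Qed.

Lemma uniq_up (x : seq 'I_n) : uniq (up x) = uniq x.
Proof. by rewrite map_inj_uniq // => a b []. Qed.

Lemma uniq_up_None (x y : seq 'I_n) : uniq (up x ++ None :: up y) = uniq (x ++ y).
Proof.
by rewrite uniq_catC /= /up -map_cat -/up mem_None_up uniq_up uniq_catC.
Qed.

Definition proper g := forall u v, e u v -> g u != g v.

(** There are [n + 1] colors in all. Confinement to [S] lets the path survive any recoloring outside
    [S]. *)
Definition on_full_path g S v :=
  exists p, [/\ sorted e p, all (mem S) p, uniq (map g p), size p = n.+1 & v \in p].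

(* Whatever block of cyclically consecutive colors ending in [b] has been
   used, the remaining colors can be collected on a path issued from [t]. *)
Definition completes g S t b :=
  [/\ t \in S, g t = None & forall a i, i < n -> iter i (@ordS n) a = b ->
    exists r, [/\ path e t r, all (mem S) r, size r = n - i.+1 &
      uniq (up (traject (@ordS n) a i.+1) ++ None :: map g r)]].

(** The block of [j + 1] colors used by the climb is the one whose complement can be collected from
    [t]. *)
Definition climbs_to_none g S s := exists a j q t,
  [/\ j < n, path e s (rcons q t), all (mem S) (s :: q),
      map g (s :: q) = up (traject (@ordS n) a j.+1) &
      completes g S t (iter j (@ordS n) a)].

Definition climbs_around g S s := exists a q,
  [/\ path e s q, all (mem S) (s :: q) &
      map g (s :: q) = up (traject (@ordS n) a n)].

(** The growth invariant: the second clause allows cyclic shifts outside [S], the last two serve to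
    attach a new neighbor of [S]. *)
Definition saturated g S :=
  [/\ proper g, forall v, v \notin S -> g v != None,
      forall v, v \in S -> on_full_path g S v,
      forall s, s \in S -> g s != None ->
        climbs_to_none g S s \/ climbs_around g S s &
      forall t, t \in S -> g t = None -> exists b, completes g S t b].

Lemma all_mem_sub (S S' : {set T}) p :
  S \subset S' -> all (mem S) p -> all (mem S') p.
Proof. by move/subsetP=> sub /allP Sp; apply/allP => x /Sp /sub. Qed.

(** * Transfer of paths to larger sets, and addition of one vertex *)

Section Extension.
Variables (g g' : T -> option 'I_n) (S S' : {set T}).
Hypotheses (sSS' : S \subset S') (eq_g : {in S, g =1 g'}).

Lemma eq_map_in_set p : all (mem S) p -> map g p = map g' p.
Proof. by move=> /allP Sp; apply/eq_in_map => x /Sp /eq_g. Qed.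

Lemma on_full_path_ext v : on_full_path g S v -> on_full_path g' S' v.
Proof.
case=> p [ep Sp uniq_p szp pv]; exists p; split=> //; first exact: all_mem_sub Sp.
by rewrite -eq_map_in_set.
Qed.

Lemma completes_ext t b : completes g S t b -> completes g' S' t b.
Proof.
case=> St gt ext; split; first exact: (subsetP sSS').
  by rewrite -eq_g.
move=> a i lt_in def_b; have [r [er Sr szr ur]] := ext a i lt_in def_b.
exists r; split=> //; first exact: all_mem_sub Sr.
by rewrite -eq_map_in_set.
Qed.

Lemma climbs_to_none_ext s : climbs_to_none g S s -> climbs_to_none g' S' s.
Proof.
case=> a [j [q [t [lt_jn eq Sq gq tb]]]]; exists a, j, q, t; split=> //.
- exact: all_mem_sub Sq.
- by rewrite -eq_map_in_set.
- exact: completes_ext.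
Qed.

Lemma climbs_around_ext s : climbs_around g S s -> climbs_around g' S' s.
Proof.
case=> a [q [eq Sq gq]]; exists a, q; split=> //; first exact: all_mem_sub Sq.
by rewrite -eq_map_in_set.
Qed.

End Extension.

(** Witnesses inside [S] persist since the color may change only at [u]. This serves both when [u]
    keeps its color and when it becomes [None]. *)
Lemma saturated_add g g' S u :
    saturated g S -> u \notin S -> {in predC1 u, g =1 g'} -> proper g' ->
    on_full_path g' (u |: S) u ->
    (g' u != None -> climbs_to_none g' (u |: S) u \/ climbs_around g' (u |: S) u) ->
    (g' u = None -> exists b, completes g' (u |: S) u b) ->
  saturated g' (u |: S).
Proof.
move=> [_ gU full climb compl] Su eq_g pr' full_u climb_u compl_u.
have sS : S \subset u |: S by apply: subsetUr.
have eqS : {in S, g =1 g'}.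
  by move=> x Sx; apply: eq_g; rewrite !inE; apply: contraNneq Su => <-.
split=> // v; rewrite !inE.
- by rewrite negb_or => /andP[vu Sv]; rewrite -eq_g ?gU.
- by case/predU1P=> [-> //|Sv]; apply: on_full_path_ext (full v Sv).
- case/predU1P=> [-> //|Sv]; rewrite -eqS // => /(climb v Sv)[cl|cl].
    by left; apply: climbs_to_none_ext cl.
  by right; apply: climbs_around_ext cl.
- case/predU1P=> [-> //|Sv]; rewrite -eqS // => /(compl v Sv)[b tb].
  by exists b; apply: completes_ext tb.
Qed.

(** The climb has [j + 1] vertices, [t] is one more, and the completing path has [n - (j + 1)]. *)
Lemma on_full_path_climb g S s a j q t :
    j < n -> path e s (rcons q t) -> all (mem S) (s :: q) ->
    map g (s :: q) = up (traject (@ordS n) a j.+1) ->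
    completes g S t (iter j (@ordS n) a) ->
  on_full_path g S s.
Proof.
move=> lt_jn eq Sq gq [St gt /(_ a j lt_jn erefl)[r [er Sr szr ur]]].
have szq : size q = j.
  by move/(congr1 size): gq; rewrite /= !size_map !size_traject => -[].
exists (s :: q ++ t :: r); rewrite mem_head; split=> //.
- move: eq; rewrite /= rcons_path cat_path => /andP[-> /= ->].
  exact: er.
- by rewrite -cat_cons all_cat Sq /= St.
- by rewrite -cat_cons map_cat gq /= gt.
- by rewrite /= size_cat /= szq szr subnSK // subnKC // ltnW.
Qed.

Lemma saturated_climb g S u a j q t :
    saturated g S -> u \notin S -> j < n -> path e u (rcons q t) ->
    all (mem S) q ->
    map g (u :: q) = up (traject (@ordS n) a j.+1) ->
    completes g S t (iter j (@ordS n) a) ->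
  saturated g (u |: S).
Proof.
move=> sat Su lt_jn eq Sq gq tb.
have sS : S \subset u |: S by apply: subsetUr.
have Sq' : all (mem (u |: S)) (u :: q).
  by rewrite /= setU11; apply: all_mem_sub Sq.
have tb' : completes g (u |: S) t (iter j (@ordS n) a) by apply: completes_ext tb.
have gu : g u != None by case: gq => ->.
apply: (saturated_add sat) => //; first by case: sat.
- exact: on_full_path_climb eq Sq' gq tb'.
- by move=> _; left; exists a, j, q, t.
- by move=> gu0; rewrite gu0 in gu.
Qed.

Lemma saturated_around g S u s a :
    saturated g S -> u \notin S -> s \in S -> e u s -> g s = Some a ->
    g u = Some (ord_pred a) -> climbs_around g S s ->
  exists g', saturated g' (u |: S).
Proof.
move=> sat Su Ss eus gs gu [a' [q [eq Sq gq]]].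
have sS : S \subset u |: S by apply: subsetUr.
have [pr gU _ _ _] := sat.
have szq : size q = n.-1.
  by move/(congr1 size): gq; rewrite /= !size_map size_traject => <-.
have def_a : a' = a.
  by move: gq; rewrite -[X in traject _ _ X](prednK n_gt0) /= gs => -[->].
rewrite {a'}def_a in gq.
have [/existsP[t /and3P[St eut /eqP gt]]|no_t] :=
    boolP [exists t, [&& t \in S, e u t & g t == None]]; last first.
  (* No vertex outside [S] is colored [None], so [u] has no neighbor of that color at all and may
     take it. *)
  pose g' x := if x == u then None else g x.
  have eq_g : {in predC1 u, g =1 g'}.
    by move=> x; rewrite !inE /g' => /negPf->.
  have Nu v : e u v -> g v != None.
    move=> euv; case: (boolP (v \in S)) => [Sv|/gU //].
    by apply: contra no_t => gv; apply/existsP; exists v; rewrite Sv euv.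
  have gq' : map g' (s :: q) = up (traject (@ordS n) a n).
    rewrite -gq; apply: esym; apply/eq_in_map => x /(allP Sq) Sx; apply: eq_g.
    by rewrite !inE; apply: contraNneq Su => <-.
  have g'u : g' u = None by rewrite /g' eqxx.
  have Sq' : all (mem (u |: S)) (s :: q) by apply: all_mem_sub Sq.
  exists g'; apply: (saturated_add sat) => //.
  - move=> x y exy; rewrite /g'; case: (eqVneq x u) => [xu|_].
      case: (eqVneq y u) => [yu|_]; first by move: (pr _ _ exy); rewrite xu yu eqxx.
      by rewrite eq_sym; apply: Nu; rewrite -xu.
    case: (eqVneq y u) => [yu|_]; last exact: pr.
    by apply: Nu; rewrite e_sym -yu.
  - exists (u :: s :: q); rewrite mem_head; split=> //.
    + by rewrite /= eus.
    + by rewrite /= setU11.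
    + by rewrite map_cons gq' g'u cons_uniq mem_None_up uniq_up uniq_traject_ordS.
    + by rewrite /= szq prednK.
  - by rewrite g'u.
  (* The climb from [s] starts at [a], just after a block ending in [ord_pred a], so its first
     [n - (i + 1)] colors are those missing from the block. *)
  move=> _; exists (ord_pred a); split=> // [|b i lt_in def_a].
    exact: setU11.
  exists (take (n - i.+1) (s :: q)); split.
  - by apply: take_path; rewrite /= eus.
  - by apply/allP => x /mem_take; apply/allP.
  - by rewrite size_takel //= szq prednK // leq_subr.
  - rewrite map_take gq' -map_take take_traject ?leq_subr //.
    rewrite uniq_up_None -{1}[a]ord_predK -def_a -iterS -trajectD subnKC //.
    exact: uniq_traject_ordS.
exists g.
(* The last vertex of the climb has the color of [u]; it is dropped and [u] put in front. *)
have gq' : map g (u :: take n.-1 (s :: q)) = up (traject (@ordS n) (ord_pred a) n).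
  rewrite map_cons gu map_take gq -map_take take_traject ?leq_pred //.
  by rewrite -[X in _ = up (traject _ _ X)](prednK n_gt0) /= ord_predK.
have Sq' : all (mem (u |: S)) (u :: take n.-1 (s :: q)).
  rewrite /= setU11; apply/allP => x /mem_take xq; apply: (subsetP sS).
  exact: (allP Sq).
have eq' : path e u (take n.-1 (s :: q)) by apply: take_path; rewrite /= eus.
apply: (saturated_add sat) => //.
- exists [:: t, u & take n.-1 (s :: q)]; rewrite !inE eqxx orbT; split=> //.
  + by rewrite /= e_sym eut.
  + by rewrite /= inE St orbT.
  + by rewrite map_cons gq' gt cons_uniq mem_None_up uniq_up uniq_traject_ordS.
  + by rewrite /= size_takel ?prednK //= szq.
- by move=> _; right; exists (ord_pred a), (take n.-1 (s :: q)).
- by rewrite gu.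
Qed.

Lemma saturated_contact g S u s a :
    saturated g S -> u \notin S -> s \in S -> e u s -> g s = Some a ->
    g u = Some (ord_pred a) ->
  exists g', saturated g' (u |: S).
Proof.
move=> sat Su Ss eus gs gu; have [_ _ _ climb _] := sat.
have [|cl|cl] := climb s Ss; first by rewrite gs.
- have [a' [j [q [t [lt_jn eq Sq gq tb]]]]] := cl.
  have def_a : a' = a by case: gq; rewrite gs => -[].
  rewrite {a'}def_a in gq tb.
  (* If [j + 1 = n], the climb already bears all cyclic colors and [u] would repeat one, so the case
     is that of [saturated_around]. *)
  have [lt_j1n|] := ltnP j.+1 n; last first.
    rewrite leq_eqVlt ltnNge lt_jn orbF => /eqP def_n.
    apply: (saturated_around sat) (eus) gs gu _ => //; exists a, q; split=> //.
      by move: eq; rewrite rcons_path => /andP[].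
    by rewrite [X in traject _ _ X]def_n.
  exists g; apply: (@saturated_climb _ _ _ (ord_pred a) j.+1 (s :: q) t) => //.
  + by rewrite /= eus.
  + by rewrite map_cons gu gq [in RHS]trajectS ord_predK.
  + by rewrite iterSr ord_predK.
- exact: saturated_around eus gs gu cl.
Qed.

(** The vertex [u] alone is a climb of one color, and [t] collects the others. *)
Lemma saturated_contact_none g S u t b :
    saturated g S -> u \notin S -> e u t -> completes g S t b ->
    g u = Some b ->
  saturated g (u |: S).
Proof.
move=> sat Su eut tb gu; apply: (@saturated_climb _ _ _ b 0 [::] t) => //.
- by rewrite /= eut.
- by rewrite /= gu.
Qed.

(** * Rotation of the outside colors, and growth to all vertices *)

Definition rotate g S x := if x \in S then g x else omap (@ordS n) (g x).

(** The shift is injective, which settles edges outside [S]; an edge between [S] and its complement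
    could fail only if the outer color just preceded the inner one. *)
Lemma saturated_rotate g S :
    saturated g S ->
    (forall u s a, u \notin S -> s \in S -> e u s -> g s = Some a ->
       g u <> Some (ord_pred a)) ->
  saturated (rotate g S) S.
Proof.
move=> [pr gU full climb compl] no_contact.
have eqS : {in S, g =1 rotate g S} by move=> x Sx; rewrite /rotate Sx.
have mix u s : u \notin S -> s \in S -> e u s -> omap (@ordS n) (g u) != g s.
  move=> Su Ss eus; apply/eqP; case gu: (g u) (gU u Su) => [c|] // _ /= gs.
  by case: (no_contact u s (ordS c) Su Ss eus (esym gs)); rewrite ordSK.
split=> [u v euv|v Sv|v Sv|s Ss|t St].
- rewrite /rotate; case: ifPn => Su; case: ifPn => Sv.
  + exact: pr.
  + by rewrite eq_sym; apply: mix => //; rewrite e_sym.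
  + exact: mix.
  + move: (pr u v euv) (gU u Su) (gU v Sv).
    case: (g u) => [c|] //; case: (g v) => [d|] //= neq _ _.
    by apply: contraNneq neq => /Some_inj/ordS_inj->.
- by rewrite /rotate (negPf Sv); case: (g v) (gU v Sv).
- by apply: on_full_path_ext (full v Sv).
- rewrite -eqS // => /(climb s Ss)[cl|cl].
    by left; apply: climbs_to_none_ext cl.
  by right; apply: climbs_around_ext cl.
- by rewrite -eqS // => /(compl t St)[b tb]; exists b; apply: completes_ext tb.
Qed.

Lemma saturated_grow g S u s :
    saturated g S -> u \notin S -> s \in S -> e u s ->
  exists g' v, v \notin S /\ saturated g' (v |: S).
Proof.
move=> sat Su Ss eus.
(* [u] can be attached once its color is [b], by [saturated_contact] or, when [s] is colored [None],
   by [saturated_contact_none]. *)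
pose aim b := g s = Some (ordS b) \/ completes g S s b.
have [b aim_b] : exists b, aim b.
  have [_ _ _ _ compl] := sat; case gs: (g s) => [a|].
    by exists (ord_pred a); left; rewrite ord_predK.
  by have [b] := compl s Ss gs; exists b; right.
have [c gu] : exists c, g u = Some c.
  by have [_ /(_ u Su)] := sat; case: (g u) => // c; exists c.
have [d] := iter_ordS_transitive c b.
(* [d] counts the rotations left until [u] has color [b]. A contact met earlier, possibly at another
   vertex, ends the process; otherwise rotation is legitimate. *)
elim: d => [|d IHd] in g c sat gu aim aim_b *.
  move=> /= def_b; rewrite {c}def_b in gu; case: aim_b => [gs|tb].
    have [|g' sat'] := saturated_contact sat Su Ss eus gs; first by rewrite ordSK.
    by exists g', u.
  by exists g, u; split=> //; apply: saturated_contact_none tb gu.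
rewrite iterSr => def_b.
pose contact (x y : T) := [&& x \notin S, y \in S, e x y &
  (omap (@ordS n) (g x) == g y)].
have [/existsP[x /existsP[y /and4P[Sx Sy exy /eqP gxy]]]|no_contact] :=
  boolP [exists x, exists y, contact x y].
  have [_ /(_ x Sx)] := sat; case gx: (g x) gxy => [a|] // gy _.
  have [|g' sat'] := saturated_contact sat Sx Sy exy (esym gy).
    by rewrite ordSK.
  by exists g', x.
apply: (IHd (rotate g S) (ordS c)) => //.
- apply: saturated_rotate => // x y a Sx Sy exy gy gx; case/negP: no_contact.
  apply/existsP; exists x; apply/existsP; exists y.
  by rewrite /contact Sx Sy exy gx gy /= ord_predK.
- by rewrite /rotate (negPf Su) gu.
- have eqS : {in S, g =1 rotate g S} by move=> x Sx; rewrite /rotate Sx.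
  case: aim_b => [gs|tb]; [left; by rewrite -eqS|right].
  exact: completes_ext tb.
Qed.

Lemma saturated_setT g S :
    (forall x y, connect e x y) -> S != set0 -> saturated g S ->
  exists g', saturated g' [set: T].
Proof.
move=> conn; have [m] := ubnP #|~: S|; elim: m => // m IHm in g S *.
rewrite ltnS => leSm S0 sat.
have [ST|] := eqVneq S setT; first by exists g; rewrite -ST.
rewrite -subTset => /subsetPn[x _ Sx]; case/set0Pn: S0 => y Sy.
have [u [s [Su Ss eus]]] : exists u s, [/\ u \notin S, s \in S & e u s].
  have /connectP[p ep def_y] := conn x y.
  elim: p => [|z p IHp] /= in x Sx ep def_y *; first by rewrite def_y (negPf Sx) in Sy.
  case/andP: ep => exz ep; case: (boolP (z \in S)) => Sz; first by exists x, z.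
  exact: IHp Sz ep def_y.
have [g' [v [Sv sat']]] := saturated_grow sat Su Ss eus.
apply: IHm sat'; last by apply/set0Pn; exists v; apply: setU11.
apply: leq_trans leSm; apply: proper_card; rewrite properE !setCS subsetUr /=.
by apply/subsetPn; exists v; rewrite ?setU11.
Qed.

(** * The initial saturated set *)

Definition none_class g := [set x | g x == None].

(* Otherwise, moving the closure of [z] one step along the order
   None, c, c - 1, ..., c + 1 removes [z] from the class of None. *)
Lemma descending_path g z c :
    proper g -> (forall h, proper h -> #|none_class g| <= #|none_class h|) ->
    g z = None ->
  exists q, path e z q && (map g q == up (traject (@ord_pred n) c n)).
Proof.
move=> pr min_g gz.
pose next o := Some (if o is Some x then ord_pred x else c).
(* Only [None] and [ordS c] share an image under [next], namely [c]. *)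
have next_inj o o' : o != Some (ordS c) -> o' != Some (ordS c) ->
    next o = next o' -> o = o'.
  case: o o' => [x|] [y|] //= nx ny /Some_inj.
  - by move/ord_pred_inj->.
  - by move=> def_c; rewrite -def_c ord_predK eqxx in nx.
  - by move=> def_c; rewrite def_c ord_predK eqxx in ny.
have trajectE i b : traject next (Some b) i = up (traject (@ord_pred n) b i).
  by elim: i b => //= i IHi b; rewrite -IHi.
pose rn := [rel x y | e x y && (g y == next (g x))].
have [/existsP[x /andP[/connectP[p rp def_x] /eqP gx]]|no_last] :=
    boolP [exists x, connect rn z x && (g x == Some (ordS c))].
  have ep : path e z p by apply: sub_path rp => a b /andP[].
  have gp : map g p = up (traject (@ord_pred n) c (size p)).
    have: fpath next (g z) (map g p).
      rewrite path_map; apply: sub_path rp => a b /andP[_ /eqP gb].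
      by rewrite /= gb.
    by move/fpathE=> ->; rewrite size_map gz trajectE.
  have p_gt0 : 0 < size p by case: p def_x {rp ep gp} => //= xz; rewrite -xz gx in gz.
  (* Colors descend from [c] along [p], so [ordS c] cannot occur before the [n]-th vertex after
     [z]. *)
  have le_np : n <= size p.
    apply: (@iter_ord_pred_full n c) => //.
    have: last (g z) (map g p) = Some (ordS c) by rewrite last_map -def_x.
    rewrite gp -(prednK p_gt0) /= -last_traject.
    by rewrite last_map => /Some_inj.
  exists (take n p); rewrite take_path //= map_take gp -map_take.
  by rewrite take_traject.
have lastN x : connect rn z x -> g x != Some (ordS c).
  by move=> zx; apply: contra no_last => gx; apply/existsP; exists x; rewrite zx.
(* On the closure of [z], which misses [ordS c], [next] is injective; an edge leaving the closure
   that became improper would be a step of [rn]. *)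
pose h x := if connect rn z x then next (g x) else g x.
have mix x y : e x y -> connect rn z x -> ~~ connect rn z y -> next (g x) != g y.
  move=> exy zx; apply: contra => /eqP gxy; apply: connect_trans zx _.
  by apply: connect1; rewrite /= exy gxy /=.
have pr_h : proper h.
  move=> x y exy; rewrite /h; case: ifPn => zx; case: ifPn => zy.
  - by apply: contraNneq (pr x y exy) => /next_inj->; rewrite ?lastN.
  - exact: mix.
  - by rewrite eq_sym; apply: mix; rewrite // e_sym.
  - exact: pr.
have := min_g h pr_h; rewrite leqNgt => /negP[].
apply: proper_card; rewrite properE; apply/andP; split.
  by apply/subsetP => x; rewrite !inE /h; case: ifP.
by apply/subsetPn; exists z; rewrite !inE ?gz // /h connect0.
Qed.

(** [S] is the union of descending paths, one for each vertex colored [None] and each starting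
    color; read backwards they are climbs. *)
Lemma saturated_none_class g :
    proper g -> (forall h, proper h -> #|none_class g| <= #|none_class h|) ->
  exists2 S : {set T}, none_class g \subset S & saturated g S.
Proof.
move=> pr min_g.
have /fin_all_exists[Q QP] (zc : T * 'I_n) : exists q, g zc.1 = None ->
    path e zc.1 q && (map g q == up (traject (@ord_pred n) zc.2 n)).
  case gz: (g zc.1) => [b|]; first by exists [::].
  by have [q] := descending_path zc.2 pr min_g gz; exists q.
pose S := [set v | [exists zc : T * 'I_n,
  (g zc.1 == None) && (v \in zc.1 :: Q zc)]].
have SQ z c : g z = None -> all (mem S) (z :: Q (z, c)).
  move=> gz; apply/allP => v vQ; rewrite !inE; apply/existsP; exists (z, c).
  by rewrite /= gz eqxx.
have eQ z c : g z = None -> path e z (Q (z, c)).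
  by move=> gz; case/andP: (QP (z, c) gz).
have gQ z c : g z = None -> map g (Q (z, c)) = up (traject (@ord_pred n) c n).
  by move=> gz; case/andP: (QP (z, c) gz) => _ /eqP.
have szQ z c : g z = None -> size (Q (z, c)) = n.
  by move=> gz; rewrite -(size_map g) gQ // size_map size_traject.
have Sz z : g z = None -> z \in S.
  by move=> gz; case/andP: (SQ z (Ordinal n_gt0) gz).
have compl z b : g z = None -> completes g S z b.
  move=> gz; split=> //; first exact: Sz.
  (* The first [n - (i + 1)] colors descending from [ord_pred a] avoid the block from [a] to [b]:
     the reversed block followed by them is one descent from [b]. *)
  move=> a i lt_in def_b; exists (take (n - i.+1) (Q (z, ord_pred a))); split.
  - exact/take_path/eQ.
  - by have /andP[_ /allP SQa] := SQ z (ord_pred a) gz; apply/allP => x /mem_take/SQa.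
  - by rewrite size_takel // szQ // leq_subr.
  - rewrite map_take gQ // -map_take take_traject ?leq_subr //.
    rewrite uniq_up_None; set x := traject _ _ _; set y := traject _ _ _.
    have /perm_uniq-> : perm_eq (x ++ y) (rev x ++ y).
      by rewrite perm_cat2r perm_sym perm_rev.
    rewrite /x /y (rev_traject _ _ (@ordSK n)).
    rewrite -[in ord_pred a](iter_cancel i (@ordSK n) a) -iterS -trajectD subnKC //.
    exact: uniq_traject_ord_pred.
exists S; first by apply/subsetP => z; rewrite inE => /eqP/Sz.
split=> //.
- by move=> v; apply: contra => /eqP/Sz.
- move=> v; rewrite inE => /existsP[[z c] /andP[/eqP gz vQ]].
  exists (z :: Q (z, c)); split=> //; first exact: eQ.
  + exact: SQ.
  + by rewrite map_cons gz gQ // cons_uniq mem_None_up uniq_up uniq_traject_ord_pred.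
  + by rewrite /= szQ.
- move=> s; rewrite inE => /existsP[[z c] /andP[/eqP gz sQ]] gs; left.
  rewrite /= in gz sQ; case/predU1P: sQ => [sz|sQ]; first by rewrite sz gz in gs.
  have lt_jn : index s (Q (z, c)) < n by rewrite -[X in _ < X](szQ z c gz) index_mem.
  set j := index _ _ in lt_jn.
  have takeE : take j.+1 (Q (z, c)) = rcons (take j (Q (z, c))) s.
    by rewrite (take_nth s) ?szQ // nth_index.
  (* The path from [z] to [s], reversed, climbs [j] steps up to color [c] and then reaches [z]. *)
  exists (iter j (@ord_pred n) c), j, (rev (take j (Q (z, c)))), z; split=> //.
  + have := take_path j.+1 (eQ z c gz); rewrite takeE => ep.
    have: path (fun x => e^~ x) z (rcons (take j (Q (z, c))) s).
      by apply: sub_path ep => x y; rewrite e_sym.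
    by rewrite -rev_path last_rcons belast_rcons rev_cons.
  + rewrite -rev_rcons -takeE all_rev; apply/allP => x /mem_take.
    by case/andP: (SQ z c gz) => _ /allP; apply.
  + rewrite -rev_rcons -takeE map_rev map_take gQ // -map_take take_traject //.
    by rewrite -map_rev (rev_traject _ _ (@ord_predK n)).
  + exact: compl.
- by move=> t _ gt; exists (Ordinal n_gt0); apply: compl.
Qed.

End RainbowGrowth.

(** * Return to ordinal colors, and the case of at most one color *)

Definition ord_of_option n (o : option 'I_n) : 'I_n.+1 :=
  if o is Some i then lift ord0 i else ord0.

Lemma ord_of_option_inj n : injective (@ord_of_option n).
Proof. by move=> [i|] [j|] //= /lift_inj->. Qed.

Lemma unlift0_inj n : injective (unlift (@ord0 n)).
Proof. by move=> i j; case: unliftP => [i'|] ->; case: unliftP => [j'|] -> // [->]. Qed.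

Lemma full_rainbow_coloring (T : finType) (e : rel T) (n : nat) :
  symmetric e -> connected_graph e -> 0 < n -> chromatic_number e n.+1 ->
  exists f : T -> 'I_n.+1, is_coloring e f /\
    forall v : T, exists p : seq T, full_rainbow_path e f p /\ v \in p.
Proof.
move=> e_sym conn n_gt0 [[f0 col0] chi].
pose properb (h : {ffun T -> option 'I_n}) :=
  [forall u, forall v, e u v ==> (h u != h v)].
have properP (h : {ffun T -> option 'I_n}) : reflect (proper e h) (properb h).
  apply: (iffP 'forall_'forall_implyP) => ph u v; exact: ph.
pose h0 := [ffun x => unlift ord0 (f0 x)].
have pr0 : properb h0.
  apply/properP => u v euv; rewrite !ffunE.
  by apply: contraNneq (col0 u v euv) => /unlift0_inj->.
case: (@arg_minnP _ h0 properb (fun h : {ffun T -> option 'I_n} => #|none_class h|) pr0) => g /properP pr min_g.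
have{} min_g (h : T -> option 'I_n) : proper e h -> #|none_class g| <= #|none_class h|.
  move=> ph; have -> : none_class h = none_class (finfun h).
    by apply/setP => x; rewrite !inE ffunE.
  by apply: min_g; apply/properP => u v; rewrite !ffunE; apply: ph.
have [S sub sat] := saturated_none_class e_sym n_gt0 pr min_g.
(* If [S] were empty, no vertex would be colored [None] and [n] colors would suffice; the default of
   [odflt] is then never taken. *)
have S0 : S != set0.
  apply/eqP => S0; apply: (chi n (ltnSn n)).
  have gN x : g x != None.
    by apply/negP => gx; move/subsetP/(_ x): sub; rewrite S0 !inE gx => /(_ isT).
  exists (fun x => odflt (Ordinal n_gt0) (g x)) => u v euv.
  move: (pr u v euv) (gN u) (gN v).
  by case: (g u) => // a; case: (g v) => // b.
have [g' [pr' _ full _ _]] := saturated_setT e_sym n_gt0 conn S0 sat.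
exists (fun x => ord_of_option (g' x)); split=> [u v euv|v].
  by apply: contraNneq (pr' u v euv) => /ord_of_option_inj->.
have [p [ep _ up szp pv]] := full v (in_setT v).
exists p; split=> //; split=> //; split; last first.
  by rewrite (map_comp (@ord_of_option n) g') (map_inj_uniq (@ord_of_option_inj n)).
by case: p szp ep up {pv} => // x p _ ep /map_uniq.
Qed.

Theorem theorem1 (T : finType) (e : rel T) (k : nat) :
  simple_graph e -> connected_graph e -> chromatic_number e k ->
  exists f : T -> 'I_k, is_coloring e f /\
    forall v : T, exists p : seq T, full_rainbow_path e f p /\ v \in p.
Proof.
(* For [k = 0] there is no vertex, and for [k = 1] a single vertex is a full path; otherwise some
   cyclic color exists besides [None]. *)
move=> [e_sym _] conn; case: k => [|[|n]] chi; last exact: full_rainbow_coloring.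
  by have [[f col] _] := chi; exists f; split=> // v; case: (f v).
have [[f col] _] := chi; exists f; split=> // v; exists [:: v].
by rewrite mem_head.
Qed.
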